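(* The logic $\mathbf{L}$ is completely incomplete: there is no class $\mathcal{C}$ of complete Boolean algebras with operators such that $\mathbf{L}$ equals the set of modal formulas valid in every member of $\mathcal{C}$.
   Context: A Boolean algebra with operators (BAO) is a structure $\langle A,\wedge,-,0,\Diamond\rangle$ where $\langle A,\wedge,-,0\rangle$ is a Boolean algebra and $\Diamond$ is a unary operation with $\Diamond 0=0$ and $\Diamond(a\vee b)=\Diamond a\vee\Diamond b$; $\Box a:=-\Diamond - a$. It is complete if the underlying Boolean algebra is complete. A modal formula is valid in a BAO if it evaluates to $1$ under every assignment of algebra elements to its variables. Define $A_i:=\Box (q_i\rightarrow r)$, $B_i:=\Box (r\rightarrow \Diamond q_i)$ for $i=1,2$, $C_1:=\Box \neg (q_1\wedge q_2)$, $A:= \big(r\wedge\Box p\wedge\neg \Box^2 p\wedge A_1\wedge A_2\wedge B_1\wedge B_2\wedge C_1\big)\rightarrow \Diamond\big(r\wedge\Box(r\rightarrow q_1\vee q_2)\big)$, $B:=\Box(p\rightarrow q)\rightarrow (\Box p\rightarrow \Box q)$, $C:=\Box p\rightarrow p$, $D:=(p\wedge \Diamond^2 q)\rightarrow (\Diamond q\vee \Diamond^2(q\wedge\Diamond p))$, $E:=(\Box p\wedge \neg \Box^2 p)\rightarrow \Diamond (\Box^2 p\wedge \neg\Box^3 p)$. $\mathbf{L}$ is the smallest set of modal formulas containing all propositional tautologies and $A,B,C,D,E$, and closed under modus ponens, uniform substitution and necessitation (from $\varphi$ infer $\Box\varphi$). (This is Thomason's 1974 logic.) *)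

(* Defs.v *)
(* MathComp world: Boolean algebras are [ctbDistrLatticeType]s; least upper
   bounds come from mathcomp-classical. *)
From mathcomp Require Import all_boot all_order.
From mathcomp Require Import classical_sets.

Set Implicit Arguments.
Unset Strict Implicit.
Unset Printing Implicit Defensive.

Import Order.TTheory.

(* [Box] rather than [Dia] is primitive on the syntactic side: if diamond were
   primitive and [Box f] short for [Neg (Dia (Neg f))], the axiom K and
   necessitation would no longer relate [Dia f] to [Dia (Neg (Neg f))], and the
   logic below would be weaker than intended. *)
Inductive formula : Type :=
  | Var of nat
  | Bot
  | Neg of formula
  | And of formula & formula
  | Box of formula.

Definition Or (f g : formula) : formula := Neg (And (Neg f) (Neg g)).
Definition Imp (f g : formula) : formula := Neg (And f (Neg g)).
Definition Dia (f : formula) : formula := Neg (Box (Neg f)).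

Declare Scope modal_scope.
Delimit Scope modal_scope with M.
Bind Scope modal_scope with formula.
Notation "~~ f" := (Neg f) : modal_scope.
Notation "f && g" := (And f g) : modal_scope.
Notation "f || g" := (Or f g) : modal_scope.
Notation "f ==> g" := (Imp f g) : modal_scope.

Fixpoint subst (s : nat -> formula) (f : formula) : formula :=
  match f with
  | Var n => s n
  | Bot => Bot
  | Neg g => Neg (subst s g)
  | And g h => And (subst s g) (subst s h)
  | Box g => Box (subst s g)
  end.

(* Variables and boxed formulas are the propositional atoms. *)
Fixpoint prop_eval (v : formula -> bool) (f : formula) : bool :=
  match f with
  | Var _ | Box _ => v f
  | Bot => false
  | Neg g => ~~ prop_eval v g
  | And g h => prop_eval v g && prop_eval v h
  end.

Definition tautology (f : formula) : Prop := forall v, prop_eval v f.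

Section Thomason.
Local Open Scope modal_scope.

Let p := Var 0.
Let q := Var 1.
Let r := Var 2.
Let q1 := Var 3.
Let q2 := Var 4.

Definition axA : formula :=
  (r && Box p && ~~ Box (Box p)
     && Box (q1 ==> r) && Box (q2 ==> r)
     && Box (r ==> Dia q1) && Box (r ==> Dia q2)
     && Box (~~ (q1 && q2)))
  ==> Dia (r && Box (r ==> q1 || q2)).

Definition axB : formula := Box (p ==> q) ==> (Box p ==> Box q).

Definition axC : formula := Box p ==> p.

Definition axD : formula :=
  (p && Dia (Dia q)) ==> (Dia q || Dia (Dia (q && Dia p))).

Definition axE : formula :=
  (Box p && ~~ Box (Box p))
  ==> Dia (Box (Box p) && ~~ Box (Box (Box p))).

End Thomason.

Inductive L : formula -> Prop :=
  | L_taut f : tautology f -> L f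
  | L_A : L axA
  | L_B : L axB
  | L_C : L axC
  | L_D : L axD
  | L_E : L axE
  | L_mp f g : L (Imp f g) -> L f -> L g
  | L_subst s f : L f -> L (subst s f)
  | L_nec f : L f -> L (Box f).

(* The display is a notational tag that MathComp order structures carry; it has
   no mathematical content.  The one-element Boolean algebra is not excluded. *)
Record bao : Type := Bao {
  bao_disp : Order.disp_t;
  bao_sort :> ctbDistrLatticeType bao_disp;
  bao_dia : bao_sort -> bao_sort;
  bao_dia0 : bao_dia \bot%O = \bot%O;
  bao_diaU : forall a b : bao_sort,
    bao_dia (a `|` b)%O = (bao_dia a `|` bao_dia b)%O
}.

Definition bao_box (A : bao) (a : A) : A := (~` bao_dia (~` a))%O.

Definition complete (A : bao) : Prop :=
  forall S : set A, exists m : A, isLub S m.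

Fixpoint eval (A : bao) (v : nat -> A) (f : formula) : A :=
  match f with
  | Var n => v n
  | Bot => \bot%O
  | Neg g => (~` eval v g)%O
  | And g h => (eval v g `&` eval v h)%O
  | Box g => bao_box (eval v g)
  end.

Definition valid (A : bao) (f : formula) : Prop :=
  forall v : nat -> A, eval v f = \top%O.

(* Main.v *)
(** Every complete algebra validating [A], [C], [D] and [E] also validates
    [Box p -> Box (Box p)], which is not a theorem of [L].

    Put [a_n = Box^(n+1) p /\ ~ Box^(n+2) p].  [E] gives [a_n <= Dia a_(n+1)],
    and [D] improves this to [a_i <= Dia a_j] for all [i < j], since [Dia a_i]
    is disjoint from [a_j] when [j >= i + 2].  Let [r] be the join of all the
    [a_n] and [q_1], [q_2] the joins over the residue classes 0, 1 modulo 3.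
    Each [a_n], hence [r], lies below [Dia] of each of the three
    residue-class joins, so [r /\ Box (r -> q_1 \/ q_2) = 0]; now [A] yields
    [a_0 <= Dia 0 = 0].  Only joins on the left of an inequality are used, so
    [Dia] need not preserve infinite joins.

    The formula is refuted in the recession frame, in which [n] sees [m] iff
    [n <= m + 1], with the finite and cofinite sets as admissible valuations. *)
From mathcomp Require Import all_boot all_order.
From mathcomp Require Import boolp classical_sets zify.
Require Import Defs.

Set Implicit Arguments.
Unset Strict Implicit.
Unset Printing Implicit Defensive.

Import Order.Theory.

Definition ax4 : formula := Imp (Box (Var 0)) (Box (Box (Var 0))).

(** * Soundness of [L] on the recession frame *)

Definition eventually_constant (P : nat -> bool) : Prop :=
  exists N b, forall n, N <= n -> P n = b.

Fixpoint sat (v : nat -> nat -> bool) (f : formula) (n : nat) : bool :=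
  match f with
  | Var i => v i n
  | Bot => false
  | Neg g => ~~ sat v g n
  | And g h => sat v g n && sat v h n
  | Box g => `[< forall m, n <= m.+1 -> sat v g m >]
  end.

Definition recession_valid (f : formula) : Prop :=
  forall v, (forall i, eventually_constant (v i)) -> forall n, sat v f n.

Lemma sat_Box v f n :
  sat v (Box f) n <-> forall m, n <= m.+1 -> sat v f m.
Proof. by split=> [/asboolP|?] //; apply/asboolP. Qed.

Lemma sat_Neg v f n : sat v (Neg f) n <-> ~ sat v f n.
Proof. by split=> /negP. Qed.

Lemma sat_And v f g n : sat v (And f g) n <-> sat v f n /\ sat v g n.
Proof. by split=> /andP. Qed.

Lemma sat_Or v f g n : sat v (Or f g) n <-> sat v f n \/ sat v g n.
Proof. by rewrite /= negb_and !negbK; split=> /orP. Qed.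

Lemma sat_Imp v f g n : sat v (Imp f g) n <-> (sat v f n -> sat v g n).
Proof. by rewrite /= negb_and negbK -implybE; split=> /implyP. Qed.

Lemma sat_Dia v f n :
  sat v (Dia f) n <-> exists2 m, n <= m.+1 & sat v f m.
Proof.
rewrite /Dia sat_Neg sat_Box; split=> [H|[m nm fm] /(_ m nm) /negP //].
apply: contrapT => nex; apply: H => m nm; apply/negP => fm.
by apply: nex; exists m.
Qed.

(** Makes soundness pass through substitution. Every point sees arbitrarily large ones, so [Box]
    sends a finite set to the empty set; it sends a cofinite set to a cofinite one. *)
Lemma sat_eventually_constant v f :
  (forall i, eventually_constant (v i)) -> eventually_constant (sat v f).
Proof.
move=> vc; elim: f => [i||f [N [b fN]]|f [N [b fN]] g [M [c gM]]|f [N [b fN]]].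
- exact: vc.
- by exists 0, false.
- by exists N, (~~ b) => n /fN /= ->.
- exists (maxn N M), (b && c) => n; rewrite geq_max => /andP[nN nM] /=.
  by rewrite fN ?gM.
- case: b fN => fN.
    by exists N.+1, true => n Nn; apply/asboolP => m nm; apply: fN; lia.
  exists 0, false => n _; apply/negbTE/negP => /sat_Box bf.
  by have := bf (maxn N n); rewrite fN ?leq_maxl // leqW ?leq_maxr // => /(_ isT).
Qed.

Lemma sat_subst v s f n :
  sat v (subst s f) n = sat (fun i => sat v (s i)) f n.
Proof.
elim: f n => //= [f IH|f IHf g IHg|f IH] n; rewrite ?IH ?IHf ?IHg //.
by apply: asbool_equiv_eq; split=> H m /H; rewrite IH.
Qed.

Lemma sat_prop_eval v f n : sat v f n = prop_eval (sat v ^~ n) f.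
Proof. by elim: f => //= [f ->|f -> g ->]. Qed.

Lemma recession_valid_axA : recession_valid axA.
Proof.
move=> v vc n; rewrite sat_Imp !sat_And.
move=> [[[[[[[[rn _] _] A1] A2] B1] B2] C1]].
have{A1} q1r m : n <= m.+1 -> v 3 m -> v 2 m.
  by move=> nm; move/sat_Box/(_ m nm)/sat_Imp: A1.
have{A2} q2r m : n <= m.+1 -> v 4 m -> v 2 m.
  by move=> nm; move/sat_Box/(_ m nm)/sat_Imp: A2.
have{B1} rq1 m : n <= m.+1 -> v 2 m -> exists2 k, m <= k.+1 & v 3 k.
  by move=> nm rm; move/sat_Box/(_ m nm)/sat_Imp/(_ rm)/sat_Dia: B1.
have{B2} rq2 m : n <= m.+1 -> v 2 m -> exists2 k, m <= k.+1 & v 4 k.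
  by move=> nm rm; move/sat_Box/(_ m nm)/sat_Imp/(_ rm)/sat_Dia: B2.
have{C1} q12 m : n <= m.+1 -> v 3 m -> v 4 m -> False.
  by move=> nm q1m q2m; move/sat_Box/(_ m nm)/sat_Neg: C1; apply; apply/sat_And.
have [N [b rN]] := vc 2.
(* If [r] is cofinite, [rq1] and [rq2] give points of [q1] and [q2] arbitrarily far out, so both are
   cofinite and meet, against [q12]. *)
case: b rN => rN.
  have [N1 [b1 q1N]] := vc 3; have [N2 [b2 q2N]] := vc 4.
  pose M := n + N + N1 + N2.
  have rM : v 2 M.+1 by rewrite rN //; lia.
  have nM : n <= M.+2 by lia.
  have [k Mk q1k] := rq1 _ nM rM; have [l Ml q2l] := rq2 _ nM rM.
  have b1T : b1 by rewrite -(q1N k) //; lia.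
  have b2T : b2 by rewrite -(q2N l) //; lia.
  by case: (q12 M); rewrite ?q1N ?q2N //; lia.
(* If [r] is finite, its last point [M] sees distinct points [k] of [q1] and [l] of [q2], both in
   [r]. Only [M - 1] and [M] are available, so [k] and [l] exhaust the points of [r] seen from
   [M]. *)
have rlt m : v 2 m -> m <= N.
  by rewrite leqNgt => rm; apply/negP => /ltnW /rN; rewrite rm.
have [M rM Mmax] := ex_maxnP (ex_intro (v 2) n rn) rlt.
have nM := Mmax n rn.
have [|k Mk q1k] := rq1 M _ rM; first lia.
have [|l Ml q2l] := rq2 M _ rM; first lia.
have kM : k <= M by apply: Mmax; apply: q1r q1k; lia.
have lM : l <= M by apply: Mmax; apply: q2r q2l; lia.
have kl : k != l.
  by apply/eqP => ekl; apply: (q12 k); rewrite // ?ekl //; lia.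
apply/sat_Dia; exists M; first lia.
apply/sat_And; split=> //; apply/sat_Box => m Mm.
apply/sat_Imp => /Mmax mM; apply/sat_Or.
by have [->|->] : m = k \/ m = l by [lia]; [left|right].
Qed.

(** If [n] does not see [m], then [m] lies below [n] and therefore sees [n]. *)
Lemma recession_valid_axD : recession_valid axD.
Proof.
move=> v _ n; rewrite sat_Imp sat_And => -[pn /sat_Dia[k nk /sat_Dia[m km qm]]].
apply/sat_Or; have [nm|mn] := leqP n m.+1.
  by left; apply/sat_Dia; exists m.
right; apply/sat_Dia; exists k => //; apply/sat_Dia; exists m => //.
by apply/sat_And; split=> //; apply/sat_Dia; exists n => //; lia.
Qed.

Lemma recession_valid_axE : recession_valid axE.
Proof.
move=> v _ n; rewrite sat_Imp sat_And sat_Neg => -[/sat_Box bp nbp].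
(* [n.+1] sees exactly the points from [n] on. Two steps from it stay within the points seen by [n],
   yet it sees [n] itself, where [Box (Box p)] fails. *)
apply/sat_Dia; exists n.+1; first lia.
apply/sat_And; split.
  by apply/sat_Box => k nk; apply/sat_Box => m km; apply: bp; lia.
apply/sat_Neg => /sat_Box/(_ n (leqnn _)); exact: nbp.
Qed.

Lemma recession_sound f : L f -> recession_valid f.
Proof.
elim=> {f} [f tf|||||| f g _ IHfg _ IHf|s f _ IH|f _ IH].
- by move=> v _ n; rewrite sat_prop_eval tf.
- exact: recession_valid_axA.
- move=> v _ n; rewrite !sat_Imp => /sat_Box pq /sat_Box bp.
  by apply/sat_Box => m nm; apply/sat_Imp: (bp m nm); apply: pq.
- by move=> v _ n; rewrite sat_Imp => /sat_Box; apply; lia.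
- exact: recession_valid_axD.
- exact: recession_valid_axE.
- by move=> v vc n; apply/sat_Imp: (IHf v vc n); apply: IHfg.
- move=> v vc n; rewrite sat_subst; apply: IH => i.
  exact: sat_eventually_constant.
- by move=> v vc n; apply/sat_Box => m _; apply: IH.
Qed.

Lemma ax4_notin_L : ~ L ax4.
Proof.
(* Failure only at 0: 2 sees 1 and 1 sees 0, but 2 does not see 0. *)
pose v (_ n : nat) := 0 < n.
have vc i : eventually_constant (v i) by exists 1, true.
move=> /recession_sound/(_ v vc 2)/sat_Imp H.
have /H/sat_Box/(_ 1 isT)/sat_Box/(_ 0 isT) : sat v (Box (Var 0)) 2.
  by apply/sat_Box => -[].
by [].
Qed.

(** * Layers and their joins in a complete algebra *)

Section Algebra.
Variable A : bao.
Local Open Scope order_scope.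
Implicit Types (x y p : A) (v : nat -> A).

Lemma meetC_eq0 x y : (x `&` ~` y == \bot) = (x <= y).
Proof. by rewrite disj_leC complK. Qed.

Lemma bao_dia_homo : {homo @bao_dia A : x y / x <= y}.
Proof. by move=> x y /join_idPl <-; rewrite bao_diaU leUr. Qed.

Lemma eval_Or v f g : eval v (Or f g) = eval v f `|` eval v g.
Proof. by rewrite /= complI !complK. Qed.

Lemma eval_Dia v f : eval v (Dia f) = bao_dia (eval v f).
Proof. by rewrite /= /bao_box !complK. Qed.

Lemma eval_Imp_top v f g :
  eval v (Imp f g) = \top <-> eval v f <= eval v g.
Proof.
rewrite -meetC_eq0 /=; split=> [H|/eqP ->]; last exact: compl0.
by rewrite -[X in X == _]complK H compl1.
Qed.

(** The exponents start at 1, so that [layer p 0] is zero exactly when [ax4] holds at [p]. *)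
Definition layer p (n : nat) : A :=
  iter n.+1 (@bao_box A) p `&` ~` iter n.+2 (@bao_box A) p.

Section Layers.
Hypotheses (validC : valid A axC) (validD : valid A axD) (validE : valid A axE).

Lemma iter_bao_box_le p m n : (m <= n)%N ->
  iter n (@bao_box A) p <= iter m (@bao_box A) p.
Proof.
move=> /subnK <-; elim: (n - m)%N => // k IH; apply: le_trans IH.
by have /eval_Imp_top := validC (fun=> iter (k + m) (@bao_box A) p).
Qed.

(** [bao_dia (layer p i)] lies below the complement of [Box^(i+3) p], whereas [layer p j] lies below
    [Box^(i+3) p]. *)
Lemma layer_dia_disjoint p i j : (i.+2 <= j)%N ->
  layer p j `&` bao_dia (layer p i) = \bot.
Proof.
move=> ij; apply/eqP; rewrite -lex0.
rewrite -(meetxC (iter i.+3 (@bao_box A) p)); apply: leI2.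
  by apply: le_trans (leIl _ _) _; apply: iter_bao_box_le.
by rewrite [iter _ _ _]/= /bao_box complK; apply: bao_dia_homo; apply: leIr.
Qed.

Lemma layer_le_dia p i j : (i < j)%N -> layer p i <= bao_dia (layer p j).
Proof.
have E n : layer p n <= bao_dia (layer p n.+1).
  have /eval_Imp_top := validE (fun=> iter n (@bao_box A) p).
  by rewrite eval_Dia.
elim: j => // j IH; rewrite ltnS leq_eqVlt => /predU1P[->//|ij].
(* With these values the second disjunct of [axD] is [Dia (Dia 0)], by disjointness. *)
have /eval_Imp_top := validD (fun k => if k is 0 then layer p i else layer p j.+1).
rewrite eval_Or !eval_Dia /= /bao_box !complK.
rewrite layer_dia_disjoint ?ltnS // !bao_dia0 joinx0; apply: le_trans.
rewrite lexI lexx /=; apply: le_trans (IH ij) _; exact: bao_dia_homo.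
Qed.

Lemma layer_disjoint p i j : (i < j)%N -> layer p j <= ~` layer p i.
Proof.
move=> ij; rewrite lexC; apply: le_trans (leIr _ _) _; rewrite leC.
by apply: le_trans (leIl _ _) _; apply: iter_bao_box_le.
Qed.

Lemma layers_disjoint p i j : i <> j -> layer p i <= ~` layer p j.
Proof.
by case: (ltngtP i j) => // ij _; [rewrite lexC|]; apply: layer_disjoint.
Qed.

End Layers.

Lemma eval_Box_top v f : eval v f = \top -> eval v (Box f) = \top.
Proof. by move=> /= ->; rewrite /bao_box compl1 bao_dia0 compl0. Qed.

Lemma bao_box_dia_disjoint x y : x `&` y = \bot -> bao_box x `&` bao_dia y = \bot.
Proof.
move=> /eqP xy; apply/eqP; rewrite disj_leC leC; apply: bao_dia_homo.
by rewrite -disj_leC meetC.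
Qed.

Lemma valid_ax4 : complete A -> valid A axA -> valid A axC -> valid A axD ->
  valid A axE -> valid A ax4.
Proof.
move=> cA vA vC vD vE v; set p := v 0; apply/eval_Imp_top.
have [r [r_ub r_lub]] := cA (range (layer p)).
pose S c : set A := fun x => exists2 n, (n %% 3)%N = c & layer p n = x.
have /choice[s sP] : forall c, exists m, isLub (S c) m by move=> c; apply: cA.
have s_ub n : layer p n <= s (n %% 3)%N.
  by apply: (sP (n %% 3)%N).1; exists n.
have s_lub c x : (forall n, (n %% 3)%N = c -> layer p n <= x) -> s c <= x.
  by move=> H; apply: (sP c).2 => _ [n nc <-]; apply: H.
have {}r_ub n : layer p n <= r by apply: r_ub; exists n.
have {}r_lub x : (forall n, layer p n <= x) -> r <= x.
  by move=> H; apply: r_lub => _ [n _ <-].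
have s_r c : s c <= r by apply: s_lub => n _; apply: r_ub.
have s_disj c d : c <> d -> s c <= ~` s d.
  move=> cd; apply: (s_lub c) => i ic; rewrite lexC; apply: s_lub => j jd.
  by apply: layers_disjoint => // ij; apply: cd; rewrite -ic -jd ij.
have r_dia c : (c < 3)%N -> r <= bao_dia (s c).
  move=> c3; apply: r_lub => n.
  (* An index above [n] in the residue class of [c]. *)
  apply: le_trans (layer_le_dia vC vD vE p (_ : n < n.+1 * 3 + c)%N) _; first lia.
  apply: bao_dia_homo; have {2}-> : c = ((n.+1 * 3 + c) %% 3)%N by lia.
  exact: s_ub.
pose w k := nth p [:: p; p; r; s 0; s 1]%N k.
have concl0 : eval w (Dia (And (Var 2) (Box (Imp (Var 2) (Or (Var 3) (Var 4))))))
    = \bot.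
  rewrite eval_Dia.
  suff -> : eval w (And (Var 2) (Box (Imp (Var 2) (Or (Var 3) (Var 4))))) = \bot.
    exact: bao_dia0.
  (* The spare class [s 2] is below [r] but disjoint from [s 0] and [s 1], so it misses
     [r -> q1 \/ q2], while [r] is below its diamond. *)
  apply/eqP; rewrite -lex0 -[X in _ <= X](@bao_box_dia_disjoint
    (eval w (Imp (Var 2) (Or (Var 3) (Var 4)))) (s 2)).
    by rewrite meetC [eval w (And _ _)]/= leI2 // r_dia.
  apply/eqP; rewrite meetC disj_leC /= complK lexI s_r /=.
  by rewrite complK lexI !s_disj.
have layer0_le0 : layer p 0 <= \bot.
  have /eval_Imp_top := vA w; rewrite concl0; apply: le_trans.
  have EA f g : eval w (And f g) = eval w f `&` eval w g by [].
  rewrite !EA !lexI.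
  (* The four boxed implications in the premise of [axA] hold as inequalities under [w], so their
     boxes are top. *)
  have E : forall f g, eval w f <= eval w g -> layer p 0 <= eval w (Box (Imp f g)).
    by move=> f g fg; rewrite eval_Box_top ?lex1 //; apply/eval_Imp_top.
  rewrite !E ?eval_Dia ?s_r ?r_dia //=.
  rewrite r_ub leIl leIr /=.
  have /eqP : s 0 `&` s 1 == \bot by rewrite disj_leC s_disj.
  by move=> ->; rewrite /bao_box complK bao_dia0 compl0 lex1.
by rewrite -meetC_eq0 -lex0; apply: layer0_le0.
Qed.

End Algebra.

Theorem theorem4 :
  ~ exists C : bao -> Prop,
      (forall A : bao, C A -> complete A) /\
      (forall f : formula, L f <-> (forall A : bao, C A -> valid A f)).
Proof.
move=> [C [cC LC]]; apply: ax4_notin_L; apply/LC => A CA.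
have vL f : L f -> valid A f by move=> /LC; apply.
by apply: valid_ax4 (cC A CA) _ _ _ _; apply: vL; constructor.
Qed.
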